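(* Let $n\geq 3$, let $K\subset\mathbb{C}^n$ be a convex body and let $x_0$ be an interior point of $K$. If for every complex affine hyperplane $H$ through $x_0$ the section $H\cap K$ is symmetric, then $K$ is symmetric.
   Context: A convex body is a compact convex subset of $\mathbb{C}^n$ with nonempty interior. $\mathbb{S}^1=\{\xi\in\mathbb{C}:|\xi|=1\}$. A set $A\subset\mathbb{C}^n$ is called symmetric if there is a translated copy $A'=A-x_0$ of $A$ such that $\xi A'=A'$ for every $\xi\in\mathbb{S}^1$; $x_0$ is then called the center of symmetry of $A$ (the empty set is also regarded as symmetric). *)

(* Defs.v *)
From mathcomp Require Import all_boot all_order all_algebra.
From mathcomp Require Import complex.
From mathcomp Require Import all_classical all_reals all_analysis.
Import Order.TTheory GRing.Theory Num.Theory numFieldNormedType.Exports.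

Set Implicit Arguments.
Unset Strict Implicit.
Unset Printing Implicit Defensive.

Local Open Scope ring_scope.
Local Open Scope classical_set_scope.
Local Open Scope complex_scope.

(* C^n, with C viewed as a numFieldType so that it carries its norm topology *)
Notation Cn R n := 'rV[Num.NumField.sort (R[i])]_n.

Definition convex_in (R : realType) (n : nat) (K : set (Cn R n)) : Prop :=
  forall x y, K x -> K y -> forall t : R, 0 <= t <= 1 ->
    K ((t%:C) *: x + ((1 - t)%:C) *: y).

Definition convex_body (R : realType) (n : nat) (K : set (Cn R n)) : Prop :=
  [/\ convex_in K, compact K & interior K !=set0].

(* A is symmetric: some translate A - x0 is invariant under multiplication
   by every unimodular complex number (the empty set qualifies trivially) *)
Definition cplx_symmetric (R : realType) (n : nat) (A : set (Cn R n)) : Prop :=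
  exists x0 : Cn R n,
    forall xi : R[i], `|xi| = 1 ->
      (fun y => xi *: y) @` ((fun y => y - x0) @` A) = (fun y => y - x0) @` A.

Definition cplx_hyperplane_through (R : realType) (n : nat)
    (x0 : Cn R n) (H : set (Cn R n)) : Prop :=
  exists a : Cn R n, a != 0 /\
    H = [set x | \sum_(i < n) a 0 i * (x 0 i - x0 0 i) = 0].

(* Main.v *)
Require Import Defs.
From mathcomp Require Import all_boot all_order all_algebra.
From mathcomp Require Import complex ring lra.
From mathcomp Require Import all_classical all_reals all_analysis.
Import Order.TTheory GRing.Theory Num.Theory numFieldNormedType.Exports.

(* Write x0 = 0 and let H range over the complex hyperplanes through 0. Choose
   r > 0 minimal with K contained in - r K; duality gives a chord [b, x] of K
   with b = - x / r and a real functional Re <., v> that is maximal on K at x and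
   minimal at b. Take x of maximal norm in its face. If H contains x and
   K `&` H has centre c, then b can be moved inside K in both directions along
   c - mid, where mid = (x + b) / 2. The directions in which b can be so moved
   form a real space U, and the complex functional V = <., x> - kappa <., v> that
   vanishes at x is injective on U because x is farthest. Hence c = mid for
   H = ker V, and also for all but at most two members of any real pencil of
   functionals a + e V with a(x) = 0 (if V = 0, for every H). For n >= 3 every point of K lies on some
   hyperplane through 0 and x, so it is a limit of points of K whose sections are
   centred at mid, and K is symmetric about mid. *)

Set Implicit Arguments.
Unset Strict Implicit.
Unset Printing Implicit Defensive.
Local Open Scope ring_scope.
Local Open Scope classical_set_scope.
Local Open Scope complex_scope.

(** * Real and imaginary parts of complex numbers *)

Section RealParts.
Variable R : realType.
Implicit Types (z w : R[i]) (t : R).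

Lemma ReD z w : complex.Re (z + w) = complex.Re z + complex.Re w.
Proof. by case: z w => [a b] [c d]. Qed.

Lemma ReN z : complex.Re (- z) = - complex.Re z.
Proof. by case: z. Qed.

Lemma ImD z w : complex.Im (z + w) = complex.Im z + complex.Im w.
Proof. by case: z w => [a b] [c d]. Qed.

Lemma ReM z w :
  complex.Re (z * w) = complex.Re z * complex.Re w - complex.Im z * complex.Im w.
Proof. by case: z w => [a b] [c d]. Qed.

Lemma ImM z w :
  complex.Im (z * w) = complex.Re z * complex.Im w + complex.Im z * complex.Re w.
Proof. by case: z w => [a b] [c d]. Qed.

Lemma ReZ t z : complex.Re (t%:C * z) = t * complex.Re z.
Proof. by rewrite ReM /= mul0r subr0. Qed.

Lemma ImZ t z : complex.Im (t%:C * z) = t * complex.Im z.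
Proof. by rewrite ImM /= mul0r addr0. Qed.

Lemma complex_eqP z w : complex.Re z = complex.Re w ->
  complex.Im z = complex.Im w -> z = w.
Proof. by case: z w => [a b] [c d] /= -> ->. Qed.

Lemma complex_normE2 z :
  complex.Re z ^+ 2 + complex.Im z ^+ 2 = complex.Re `|z| ^+ 2.
Proof.
by rewrite normc_def /= sqr_sqrtr// addr_ge0 ?sqr_ge0.
Qed.

(** [s * (s * N)] is the squared norm of [s] times a vector of squared norm [N]; allowing every
    smaller [s] lets several scales be used at once. *)
Lemma small_scale (e N : R) : 0 < e -> 0 <= N ->
  exists2 t, 0 < t & forall s, 0 < s <= t -> s * (s * N) < e.
Proof.
move=> e0 N0; have eN : 0 < e + N by rewrite ltr_pwDl.
have t0 : 0 < e / (e + N) by rewrite divr_gt0.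
exists (e / (e + N)) => // s /andP[s0 st].
have s1 : s <= 1 by rewrite (le_trans st)// ler_pdivrMr// mul1r lerDl.
have seN : s * (e + N) <= e by rewrite -ler_pdivlMr.
apply: (@le_lt_trans _ _ (s * N)); first by rewrite ler_piMl// mulr_ge0// ltW.
by have := mulr_gt0 s0 e0; lra.
Qed.

(** Turning [z] onto the positive real axis gives [|z| <= Re z], which leaves no room for an
    imaginary part. *)
Lemma rotation_max_real z :
  (forall xi : R[i], `|xi| = 1 -> complex.Re (xi * z) <= complex.Re z) ->
  complex.Im z = 0.
Proof.
move=> H; have [->//|z0] := eqVneq z 0.
have nz0 : `|z| != 0 by rewrite normr_eq0.
have := H (z^*%C / `|z|).
rewrite normf_div normcJ normr_id divff// => /(_ erefl).
have -> : z^*%C / `|z| * z = `|z|.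
  by rewrite mulrAC [_ * z]mulrC -sqr_normc expr2 mulfK.
move=> {}H.
have N0 : 0 <= complex.Re `|z|.
  by rewrite normc_def /= sqrtr_ge0.
have := complex_normE2 z; nra.
Qed.
End RealParts.

(** * Complex linear functionals and the Euclidean structure of C^n *)

Section Pairing.
Variables (R : realType) (n : nat).
Implicit Types (a y v u : Cn R n) (t : R) (c : R[i]).

(** Bilinear, without conjugation, so that [a] acts as the complex linear functional in the equation
    of a hyperplane. *)
Definition pairing a y : R[i] := \sum_i a 0 i * y 0 i.

Lemma pairingDr a y u : pairing a (y + u) = pairing a y + pairing a u.
Proof.
by rewrite /pairing -big_split /=; apply: eq_bigr => i _; rewrite mxE mulrDr.
Qed.

Lemma pairingZr a c y : pairing a (c *: y) = c * pairing a y.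
Proof.
by rewrite /pairing mulr_sumr; apply: eq_bigr => i _; rewrite mxE mulrCA.
Qed.

Lemma pairingDl a v y : pairing (a + v) y = pairing a y + pairing v y.
Proof.
by rewrite /pairing -big_split /=; apply: eq_bigr => i _; rewrite mxE mulrDl.
Qed.

Lemma pairingZl a c y : pairing (c *: a) y = c * pairing a y.
Proof.
by rewrite /pairing mulr_sumr; apply: eq_bigr => i _; rewrite mxE mulrA.
Qed.

Lemma pairing0r a : pairing a 0 = 0.
Proof. by rewrite -(scale0r (0 : Cn R n)) pairingZr mul0r. Qed.

Lemma pairing0l y : pairing 0 y = 0.
Proof. by rewrite -(scale0r (0 : Cn R n)) pairingZl mul0r. Qed.

Lemma pairingNr a y : pairing a (- y) = - pairing a y.
Proof. by rewrite -scaleN1r pairingZr mulN1r. Qed.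

Lemma pairingBr a y u : pairing a (y - u) = pairing a y - pairing a u.
Proof. by rewrite pairingDr pairingNr. Qed.

Lemma pairingNl a y : pairing (- a) y = - pairing a y.
Proof. by rewrite -scaleN1r pairingZl mulN1r. Qed.

Lemma pairing_neq0 a : a != 0 -> exists y, pairing a y = 1.
Proof.
move=> /rV0Pn[j aj]; exists (\row_i ((i == j)%:R / a 0 j)).
rewrite /pairing (bigD1 j)//= mxE eqxx mul1r divff// big1 ?addr0// => i ij.
by rewrite mxE (negbTE ij) mul0r mulr0.
Qed.

(** Two linear conditions on at least three coordinates of [a]: here [n >= 3] enters. *)
Lemma common_annihilator x y : (3 <= n)%N ->
  exists2 a, a != 0 & pairing a x = 0 /\ pairing a y = 0.
Proof.
move=> n3; pose M : 'M[R[i]]_(n, 1 + 1) := row_mx x^T y^T.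
have K0 : kermx M != 0.
  rewrite -mxrank_eq0 mxrank_ker subn_eq0 -ltnNge.
  exact: leq_ltn_trans (rank_leq_col _) n3.
have /rowV0Pn[a aK a0] := K0; exists a => //.
move/sub_kermxP: aK; rewrite /M mul_mx_row => /eqP.
rewrite row_mx_eq0 => /andP[/eqP ax /eqP ay].
have E (u : Cn R n) : a *m u^T = 0 -> pairing a u = 0.
  move=> /matrixP/(_ 0 0); rewrite !mxE => <-.
  by apply: eq_bigr => i _; rewrite mxE.
by split; apply: E.
Qed.

Definition conjv v : Cn R n := map_mx (@conjc R) v.
(** The Euclidean inner product of C^n viewed as R^(2n). *)
Definition rdot y v : R := complex.Re (pairing (conjv v) y).
Definition nsq y : R := rdot y y.

Lemma rdotE y v : rdot y v = \sum_i (complex.Re (y 0 i) * complex.Re (v 0 i)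
  + complex.Im (y 0 i) * complex.Im (v 0 i)).
Proof.
rewrite /rdot /pairing (big_morph _ (@ReD R) (erefl : complex.Re (0 : R[i]) = 0)).
apply: eq_bigr => i _; rewrite mxE.
by case: (y 0 i) (v 0 i) => [p q] [p' q'] /=; ring.
Qed.

Lemma rdotC y v : rdot y v = rdot v y.
Proof. by rewrite !rdotE; apply: eq_bigr => i _; ring. Qed.

Lemma rdotDl y u v : rdot (y + u) v = rdot y v + rdot u v.
Proof. by rewrite /rdot pairingDr ReD. Qed.

Lemma rdotZl t y v : rdot (t%:C *: y) v = t * rdot y v.
Proof. by rewrite /rdot pairingZr ReZ. Qed.

Lemma rdotNl y v : rdot (- y) v = - rdot y v.
Proof. by rewrite /rdot pairingNr; case: pairing. Qed.

Lemma rdotDr y u v : rdot v (y + u) = rdot v y + rdot v u.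
Proof. by rewrite !(rdotC v) rdotDl. Qed.

Lemma rdotZr t y v : rdot v (t%:C *: y) = t * rdot v y.
Proof. by rewrite !(rdotC v) rdotZl. Qed.

Lemma rdotNr y v : rdot v (- y) = - rdot v y.
Proof. by rewrite !(rdotC v) rdotNl. Qed.

Definition rdot_linE := (rdotDl, rdotDr, rdotNl, rdotNr, rdotZl, rdotZr).

Lemma pairing_conjvv y : pairing (conjv y) y = (nsq y)%:C.
Proof.
rewrite /nsq /rdot; apply/eqP; rewrite eq_complex /= eqxx /=.
rewrite /pairing (big_morph _ (@ImD R) (erefl : complex.Im (0 : R[i]) = 0)).
rewrite big1// => i _; rewrite mxE.
by case: (y 0 i) => [p q] /=; ring.
Qed.

Lemma nsq_coord y i :
  complex.Re (y 0 i) ^+ 2 + complex.Im (y 0 i) ^+ 2 <= nsq y.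
Proof.
rewrite /nsq rdotE (bigD1 i)//= -!expr2 lerDl sumr_ge0// => j _.
by rewrite -!expr2 addr_ge0 ?sqr_ge0.
Qed.

Lemma nsq_ge0 y : 0 <= nsq y.
Proof.
by rewrite /nsq rdotE sumr_ge0// => j _; rewrite -!expr2 addr_ge0 ?sqr_ge0.
Qed.

Lemma nsq_eq0 y : nsq y <= 0 -> y = 0.
Proof.
move=> H; apply/rowP => i; rewrite [RHS]mxE.
have := nsq_coord y i; have := sqr_ge0 (complex.Re (y 0 i)).
have := sqr_ge0 (complex.Im (y 0 i)) => h1 h2 h3.
apply/eqP; rewrite eq_complex/= -(sqrf_eq0 (complex.Re _)) -(sqrf_eq0 (complex.Im _)).
by apply/andP; split; apply/eqP; lra.
Qed.

Lemma nsq_gt0 y : y != 0 -> 0 < nsq y.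
Proof.
by move=> y0; rewrite ltNge; apply: contra y0 => /nsq_eq0 ->.
Qed.

Lemma nsqN y : nsq (- y) = nsq y.
Proof. by rewrite /nsq rdotNl rdotNr opprK. Qed.

Lemma nsqZ c y : nsq (c *: y) = complex.Re `|c| ^+ 2 * nsq y.
Proof.
rewrite /nsq !rdotE mulr_sumr; apply: eq_bigr => i _; rewrite mxE -complex_normE2.
by case: c (y 0 i) => [p q] [p' q'] /=; ring.
Qed.

Lemma nsqB y u : nsq (y - u) = nsq y - 2 * rdot y u + nsq u.
Proof. by rewrite /nsq !rdot_linE (rdotC u y); ring. Qed.

(** Young's inequality, from [nsq (e y - u) >= 0]; it stands in for Cauchy-Schwarz and avoids square
    roots. *)
Lemma rdot_le (e : R) y u : 0 < e -> 2 * rdot y u <= e * nsq y + nsq u / e.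
Proof.
move=> e0; have := nsq_ge0 (e%:C *: y - u).
rewrite {1}/nsq !rdot_linE -/(nsq y) -/(nsq u) (rdotC u) => H.
rewrite -subr_ge0 -(pmulr_rge0 _ e0).
have -> : e * (e * nsq y + nsq u / e - 2 * rdot y u) =
  e * (e * nsq y) + nsq u - 2 * e * rdot y u by field; rewrite gt_eqF.
by move: H; lra.
Qed.
End Pairing.

(** * Continuity and compactness *)

Section Topology.
Variable R : realType.

Lemma Re_continuous :
  continuous (fun z : Num.NumField.sort R[i] => complex.Re z : R).
Proof.
move=> z; apply/(@cvgrPdist_lt _ _ _ (nbhs z) (nbhs_filter z)) => e e0.
have e0' : 0 < e%:C :> R[i] by rewrite ltcR.
apply/nbhs_ballP; exists e%:C => // w.
rewrite /ball /= => zw; rewrite -ltcR; apply: le_lt_trans zw.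
have := normc_ge_Re (z - w); by case: (z) (w) => [a b] [c d].
Qed.

Lemma Im_continuous :
  continuous (fun z : Num.NumField.sort R[i] => complex.Im z : R).
Proof.
move=> z; have -> : (fun z : Num.NumField.sort R[i] => complex.Im z : R) =
  (fun z => complex.Re (-'i * z)).
  by apply/funext => -[a b] /=; ring.
apply: (@continuous_comp _ _ _ (fun z => - 'i * z : Num.NumField.sort R[i]));
  last exact: Re_continuous.
exact: mulrl_continuous.
Qed.

Variable n : nat.

Lemma Re_coord_continuous i : continuous (fun y : Cn R n => complex.Re (y 0 i) : R).
Proof.
move=> y; apply: (@continuous_comp _ _ _ (fun y : Cn R n => y 0 i)).
  exact: coord_continuous.
exact: Re_continuous.
Qed.

Lemma Im_coord_continuous i : continuous (fun y : Cn R n => complex.Im (y 0 i) : R).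
Proof.
move=> y; apply: (@continuous_comp _ _ _ (fun y : Cn R n => y 0 i)).
  exact: coord_continuous.
exact: Im_continuous.
Qed.

Lemma rdot_continuous (v : Cn R n) : continuous (fun y => rdot y v).
Proof.
under eq_fun do rewrite rdotE.
apply: (continuous_big add_continuous) => i _ y.
exact: (cvgD (cvgM (@Re_coord_continuous i y) (cvg_cst _))
             (cvgM (@Im_coord_continuous i y) (cvg_cst _))).
Qed.

Lemma nsq_continuous : continuous (@nsq R n).
Proof.
rewrite /nsq; under eq_fun do rewrite rdotE.
apply: (continuous_big add_continuous) => i _ y.
exact: (cvgD (cvgM (@Re_coord_continuous i y) (@Re_coord_continuous i y))
             (cvgM (@Im_coord_continuous i y) (@Im_coord_continuous i y))).
Qed.

Lemma nsq_sub_continuous (p : Cn R n) : continuous (fun y : Cn R n => nsq (y - p)).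
Proof.
under eq_fun do rewrite nsqB; move=> y.
exact: (cvgD (cvgB (@nsq_continuous y) (cvgM (cvg_cst _) (@rdot_continuous p y)))
  (cvg_cst _)).
Qed.

Lemma nbhs_nsq (K : set (Cn R n)) (p : Cn R n) : nbhs p K ->
  exists2 d : R, 0 < d & forall y, nsq y < d -> K (y + p).
Proof.
move=> /nbhs_ballP[[e e'] /=]; rewrite ltcE /= => /andP[/eqP -> e0] eK.
(* [e] is a radius for the maximum norm, and [nsq] dominates the squared modulus of each
   coordinate. *)
exists (e ^+ 2); first by rewrite exprn_gt0.
move=> y ye; apply: eK; split=> [|i j]; first by rewrite ltcE /= eqxx.
rewrite /ball /= mxE opprD addrCA subrr addr0 normrN ord1.
rewrite normc_def ltcR -[ltRHS](gtr0_norm e0) -sqrtr_sqr ltr_sqrt ?exprn_gt0//.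
by apply: le_lt_trans ye; exact: nsq_coord.
Qed.

Lemma compact_level (K : set (Cn R n)) (f : Cn R n -> R) (c : R) :
  compact K -> continuous f -> compact (K `&` [set y | f y = c]).
Proof.
move=> cK cf; apply: compact_closedI => //.
exact: (closed_comp (fun y _ => cf y) (@closed_eq R c)).
Qed.

(** A point of [K] nearest to [y] must be [y] itself. *)
Lemma nsq_limit (K : set (Cn R n)) y : compact K ->
  (forall d : R, 0 < d -> exists2 z, K z & nsq (z - y) < d) -> K y.
Proof.
move=> cK H; have [z Kz _] := H 1 ltr01.
have [//||q Kq qmin] := @compact_EVT_min _ R (fun z : Cn R n => nsq (z - y)) K _ cK.
- by exists z.
- exact/continuous_subspaceT/nsq_sub_continuous.
rewrite inE in Kq.
suff /nsq_eq0/eqP : nsq (q - y) <= 0 by rewrite subr_eq0 => /eqP <-.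
rewrite leNgt; apply/negP => /H[w Kw]; rewrite ltNge qmin// inE//.
Qed.
End Topology.

(** * Support functions, separation and the extremal chord *)

Section SupportFunction.
Variables (R : realType) (n : nat) (K : set (Cn R n)).
Hypotheses (convK : convex_in K) (compK : compact K).
Variable d : R.
Hypotheses (d_gt0 : 0 < d) (ballK : forall y, nsq y < d -> K y).

Definition supp v : R := sup [set rdot y v | y in K].

Let K0 : K 0.
Proof.
by apply: ballK; rewrite /nsq rdotE big1// => i _; rewrite mxE /= mulr0 addr0.
Qed.

Lemma rdot0l v : rdot (0 : Cn R n) v = 0.
Proof. by rewrite /rdot pairing0r. Qed.

Lemma supp_attained v :
  exists2 x, K x & supp v = rdot x v /\ forall y, K y -> rdot y v <= rdot x v.
Proof.
have [//||x Kx xmax] := @compact_EVT_max _ R (fun y => rdot y v) K _ compK.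
- by exists 0.
- exact/continuous_subspaceT/rdot_continuous.
rewrite inE in Kx; have {}xmax y : K y -> rdot y v <= rdot x v.
  by move=> Ky; apply: xmax; rewrite inE.
exists x => //; split=> //; apply/eqP; rewrite eq_le; apply/andP; split.
  by apply: sup_le_ub; [exists (rdot 0 v); exists 0|move=> _ [y Ky <-]; exact: xmax].
apply: ub_le_sup; last by exists x.
by exists (rdot x v) => _ [y Ky <-]; exact: xmax.
Qed.

Lemma supp_ge y v : K y -> rdot y v <= supp v.
Proof. by have [x Kx [-> xmax]] := supp_attained v; exact: xmax. Qed.

Lemma supp_gt0 v : v != 0 -> 0 < supp v.
Proof.
move=> v0; have [t t0 /(_ t)] := small_scale d_gt0 (nsq_ge0 v).
rewrite t0 lexx -rdotZl -rdotZr => /(_ erefl) tv.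
apply: lt_le_trans (supp_ge v (ballK tv)).
by rewrite rdotZl mulr_gt0// nsq_gt0.
Qed.

Lemma suppZ (t : R) v : 0 < t -> supp (t%:C *: v) = t * supp v.
Proof.
move=> t0; apply/eqP; rewrite eq_le; apply/andP; split.
  have [x Kx [-> _]] := supp_attained (t%:C *: v).
  by rewrite rdot_linE ler_pM2l// supp_ge.
have [x Kx [-> _]] := supp_attained v.
by rewrite -rdotZr supp_ge.
Qed.

Lemma body_bounded : exists2 M : R, 0 < M & forall y, K y -> nsq y <= M.
Proof.
have [//||x Kx xmax] := @compact_EVT_max _ R (@nsq R n) K _ compK.
- by exists 0.
- exact/continuous_subspaceT/nsq_continuous.
exists (nsq x + 1); first by rewrite ltr_wpDl// nsq_ge0.
by move=> y Ky; rewrite (@le_trans _ _ (nsq x)) ?xmax ?inE// lerDl.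
Qed.

(** Minimised over [e], the hypothesis is the Lipschitz bound
    [f v - f u <= sqrt (M * nsq (v - u))]. *)
Lemma nsq_modulus_continuous (M : R) (f : Cn R n -> R) : 0 < M ->
  (forall (v u : Cn R n) (e : R), 0 < e ->
     2 * (f v - f u) <= e * M + nsq (v - u) / e) ->
  continuous f.
Proof.
move=> M0 H v; apply/(@cvgrPdist_lt _ _ _ (nbhs v) (nbhs_filter v)) => e e0.
pose eta := e / M; have eta0 : 0 < eta by rewrite divr_gt0.
have etaM : eta * M = e by rewrite /eta divfK// gt_eqF.
have vv : nsq (v - v) < e * eta.
  by rewrite subrr /nsq rdot0l mulr_gt0.
have := (@cvgr_lt _ _ _ (nbhs_filter v) _ _ (@nsq_sub_continuous R n v v)) _ vv.
apply: filterS => u uv.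
have {}uv : nsq (u - v) / eta < e by rewrite ltr_pdivrMr.
have vu : nsq (v - u) = nsq (u - v).
  by rewrite -opprB nsqN.
have := H v u eta eta0; have := H u v eta eta0; rewrite vu etaM => h1 h2.
by rewrite ltr_norml; apply/andP; split; lra.
Qed.

Lemma supp_modulus (M : R) : (forall y, K y -> nsq y <= M) ->
  forall (v u : Cn R n) (e : R), 0 < e ->
     2 * (supp v - supp u) <= e * M + nsq (v - u) / e.
Proof.
move=> KM v u e e0; have [x Kx [-> _]] := supp_attained v.
have := supp_ge u Kx; have := rdot_le x (v - u) e0.
have : e * nsq x <= e * M by rewrite ler_pM2l// KM.
by rewrite rdotDr rdotNr; lra.
Qed.

(** The ratio [supp u / supp (- u)] is invariant under positive scaling, so its maximum over a
    sphere is global. The final inequality is the dual form of the inclusion of [K] in [- r K]. *)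
Lemma extremal_ratio : (0 < n)%N -> exists v r,
  [/\ 0 < r, v != 0, supp v = r * supp (- v) &
      forall u, u != 0 -> supp u <= r * supp (- u)].
Proof.
move=> n0; have [M M0 KM] := body_bounded.
have cs : continuous supp := nsq_modulus_continuous M0 (supp_modulus KM).
have csN : continuous (fun v : Cn R n => supp (- v)).
  apply: (nsq_modulus_continuous M0) => v u e e0.
  have -> : nsq (v - u) = nsq (- v - - u).
    by rewrite -opprD nsqN.
  exact: supp_modulus.
(* This sphere lies in the ball inside [K], so it inherits compactness from [K]. *)
pose S := K `&` [set y | nsq y = d / 2].
have cS : compact S by apply: compact_level compK _; exact: nsq_continuous.
have toS u : u != 0 -> exists2 t : R, 0 < t & S (t%:C *: u).
  move=> /nsq_gt0 u0; pose t := Num.sqrt (d / 2 / nsq u).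
  have q0 : 0 < d / 2 / nsq u by rewrite !divr_gt0.
  have t0 : 0 < t by rewrite sqrtr_gt0.
  have E : nsq (t%:C *: u) = d / 2.
    rewrite /nsq rdotZl rdotZr mulrA -expr2 sqr_sqrtr ?(ltW q0)// divfK//.
    by rewrite gt_eqF.
  by exists t => //; split=> //; apply: ballK; rewrite E; have := d_gt0; lra.
have Sn0 v : S v -> v != 0.
  move=> [_ /= vd]; apply/eqP => v0.
  by move: vd; rewrite v0 /nsq rdot0l => vd; have := d_gt0; lra.
have [e0 e00] : exists e0 : Cn R n, e0 != 0.
  by exists (delta_mx 0 (Ordinal n0)); apply/rV0Pn; exists (Ordinal n0);
    rewrite mxE !eqxx oner_eq0.
have [//||v Sv vmax] :=
  @compact_EVT_max _ R (fun y : Cn R n => supp y / supp (- y)) S _ cS.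
- by have [t _ St] := toS _ e00; exists (t%:C *: e0).
- apply: continuous_in_subspaceT => u; rewrite inE => /Sn0 u0.
  apply: (cvgM (cs u) (cvgV _ (csN u))).
  by rewrite gt_eqF// supp_gt0// oppr_eq0.
rewrite inE in Sv; have v0 := Sn0 _ Sv.
have sv := supp_gt0 v0; have svN : 0 < supp (- v) by rewrite supp_gt0// oppr_eq0.
exists v, (supp v / supp (- v)); split => //.
- by rewrite divr_gt0.
- by rewrite divfK// gt_eqF.
move=> u u0; have [t t0 St] := toS u u0.
have uN : 0 < supp (- u) by rewrite supp_gt0// oppr_eq0.
have := vmax (t%:C *: u); rewrite inE => /(_ St).
by rewrite -scalerN !suppZ// -mulf_div divff ?gt_eqF// mul1r ler_pdivrMr.
Qed.

Lemma strict_separation p : ~ K p ->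
  exists u, forall z, K z -> rdot z u < rdot p u.
Proof.
move=> Kp; have [//||q Kq qmin] :=
  @compact_EVT_min _ R (fun z : Cn R n => nsq (z - p)) K _ compK.
- by exists 0.
- exact/continuous_subspaceT/nsq_sub_continuous.
(* [q] is the point of [K] nearest to [p], and [p - q] is an outer normal there. *)
rewrite inE in Kq; exists (p - q) => z Kz.
have pq0 : p - q != 0 by apply: contra_notN Kp; rewrite subr_eq0 => /eqP ->.
suff : rdot (z - q) (p - q) <= 0.
  have := nsq_gt0 pq0; rewrite /nsq !rdot_linE; lra.
(* Moving [q] towards [z] by the fraction [t] cannot bring it closer to [p]. *)
have H (t : R) : 0 < t <= 1 -> 2 * rdot (z - q) (p - q) <= t * nsq (z - q).
  move=> /andP[t0 t1]; rewrite -subr_ge0 -(pmulr_rge0 _ t0).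
  have /qmin : t%:C *: z + (1 - t)%:C *: q \in K.
    by rewrite inE; apply: convK => //; rewrite (ltW t0).
  have -> : t%:C *: z + (1 - t)%:C *: q - p = t%:C *: (z - q) - (p - q).
    by apply/rowP => i; rewrite !mxE rmorphB rmorph1; ring.
  rewrite -(opprB p q) nsqN (nsqB (_ *: _)) /nsq !rdotZl rdotZr -!/(nsq _); lra.
rewrite leNgt; apply/negP => a0; set a := rdot _ _ in H a0.
have N0 := nsq_ge0 (z - q); set N := nsq _ in H N0.
(* For this [t] the bound becomes [2 a (a + N) <= a N], impossible for [a > 0]. *)
have := H (a / (a + N)); rewrite divr_gt0 ?ltr_wpDr// ler_pdivrMr ?ltr_wpDr//.
rewrite mul1r lerDl N0 => /(_ erefl).
rewrite mulrAC ler_pdivlMr ?ltr_wpDr//; nra.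
Qed.

(* The dual form of maximising the ratio in which 0 divides a chord of K:
   the maximiser of supp v / supp (- v) is normal to K at an endpoint of such
   a chord. *)
Lemma extremal_chord : (0 < n)%N -> exists v r x,
  [/\ [/\ 0 < r, K x & 0 < rdot x v],
      forall y, K y -> rdot y v <= rdot x v,
      forall y, K y -> - rdot x v <= r * rdot y v &
      forall y, K y -> K (- (r^-1)%:C *: y)].
Proof.
move=> n0; have [v [r [r0 v0 vr rmax]]] := extremal_ratio n0.
have [x Kx [xv xmax]] := supp_attained v.
exists v, r, x; split=> //; first by split=> //; rewrite -xv supp_gt0.
- by move=> y Ky; have := supp_ge (- v) Ky; rewrite -xv vr rdotNr; nra.
(* A [u] separating [- y / r] from [K] would give [r * supp u < supp (- u)], against the maximality
   of [r] at [- u]. *)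
move=> y Ky; apply: contrapT => /strict_separation[u usep].
have u0 : u != 0.
  apply/eqP => u0; have := usep _ K0.
  by rewrite u0 !(rdotC _ 0) !rdot0l ltxx.
have [z Kz [zu _]] := supp_attained u.
have := usep z Kz; have := rmax (- u); rewrite oppr_eq0 opprK => /(_ u0).
have := supp_ge (- u) Ky; rewrite -zu -rmorphN rdotZl rdotNr mulNr.
move=> h1 h2 h3.
have : r * supp u < r * - (r^-1 * rdot y u) by rewrite ltr_pM2l.
by rewrite mulrN mulrA divff ?gt_eqF// mul1r; lra.
Qed.
End SupportFunction.

(** * Central sections and their centres *)

Section Core.
Variables (R : realType) (n : nat) (K : set (Cn R n)).
Implicit Types (a c u w y : Cn R n).
Hypotheses (n3 : (3 <= n)%N) (convK : convex_in K) (compK : compact K).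
Variable d : R.
Hypotheses (d_gt0 : 0 < d) (ballK : forall y, nsq y < d -> K y).

(** Membership in [K] suffices: the rotated point stays in the hyperplane because [c] lies in it,
    and the reverse inclusion comes from [xi^-1]. *)
Definition section_center a c := pairing a c = 0 /\
  forall (xi : R[i]) y, `|xi| = 1 -> K y -> pairing a y = 0 -> K (c + xi *: (y - c)).

Hypothesis symK : forall a, a != 0 -> exists c, section_center a c.

Variables (v x : Cn R n) (r : R).
Hypotheses (r_gt0 : 0 < r) (Kx : K x) (xv_gt0 : 0 < rdot x v).
Hypothesis xmax : forall y, K y -> rdot y v <= rdot x v.
Hypothesis xmin : forall y, K y -> - rdot x v <= r * rdot y v.
Hypothesis Kopp : forall y, K y -> K (- (r^-1)%:C *: y).
Hypothesis xfar : forall y, K y -> rdot y v = rdot x v -> nsq y <= nsq x.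

Let b : Cn R n := - (r^-1)%:C *: x.
Let mid : Cn R n := (2^-1)%:C *: (x + b).

Let Kb : K b. Proof. exact: Kopp. Qed.

Let rdot_b : r * rdot b v = - rdot x v.
Proof. by rewrite /b -rmorphN rdotZl mulNr mulrN mulrA divff ?gt_eqF// mul1r. Qed.

(** * The cone of feasible directions at the endpoint [b] *)

Definition feasible u := exists2 s : R, 0 < s & K (b + s%:C *: u).

Lemma feasible0 : feasible 0.
Proof. by exists 1 => //; rewrite scaler0 addr0. Qed.

Lemma feasibleZ (t : R) u : 0 < t -> feasible u -> feasible (t%:C *: u).
Proof.
move=> t0 [s s0 Ks]; exists (s / t); first by rewrite divr_gt0.
by rewrite scalerA -rmorphM divfK// gt_eqF.
Qed.

Lemma feasibleD u w : feasible u -> feasible w -> feasible (u + w).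
Proof.
move=> [s s0 Ks] [t t0 Kt]; have st : 0 < s + t by rewrite addr_gt0.
have st0 : s + t != 0 by rewrite gt_eqF.
(* The weights [t / (s + t)] and [s / (s + t)] give [u] and [w] this common coefficient. *)
exists (s * t / (s + t)); first by rewrite divr_gt0// mulr_gt0.
have : 0 <= t / (s + t) <= 1.
  by rewrite divr_ge0 ?(ltW t0) ?(ltW st)//= ler_pdivrMr// mul1r lerDr ltW.
move=> /(convK Ks Kt); set k := t / (s + t); congr K.
have E1 : (s * t / (s + t))%:C = k%:C * s%:C :> R[i].
  by rewrite -rmorphM; congr (_%:C); rewrite /k; field.
have E2 : (s * t / (s + t))%:C = (1 - k%:C) * t%:C :> R[i].
  rewrite -(rmorph1 (real_complex R)) -rmorphB -rmorphM.
  by congr (_%:C); rewrite /k; field.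
apply/rowP => i; rewrite !mxE [in RHS]mulrDr {1}E1 E2 rmorphB rmorph1; ring.
Qed.

Lemma feasible_rdot u : feasible u -> 0 <= rdot u v.
Proof.
move=> [s s0 /xmin]; rewrite rdotDl rdotZl mulrDr rdot_b => h.
have : 0 <= r * (s * rdot u v) by lra.
by rewrite pmulr_rge0// pmulr_rge0.
Qed.

Definition lineality u := feasible u /\ feasible (- u).

Lemma linealityZ (t : R) u : lineality u -> lineality (t%:C *: u).
Proof.
move=> [u1 u2]; rewrite /lineality -scalerN.
have [t0|t0|->] := ltrgt0P t; last by rewrite !scale0r; split; exact: feasible0.
  by split; apply: feasibleZ.
have tE (w : Cn R n) : t%:C *: w = (- t)%:C *: (- w).
  by rewrite rmorphN scalerN scaleNr opprK.
by rewrite (tE u) (tE (- u)) opprK; split; apply: feasibleZ => //; rewrite oppr_gt0.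
Qed.

Lemma linealityD u w : lineality u -> lineality w -> lineality (u + w).
Proof.
by move=> [u1 u2] [w1 w2]; rewrite /lineality opprD; split; exact: feasibleD.
Qed.

Lemma lineality_rdot u : lineality u -> rdot u v = 0.
Proof.
move=> [/feasible_rdot u1 /feasible_rdot]; rewrite rdotNl => u2.
by apply/eqP; rewrite eq_le u1 -oppr_ge0 u2.
Qed.

Lemma reflect_section a c y : section_center a c -> K y -> pairing a y = 0 ->
  K (c + c - y).
Proof.
move=> [_ H] Ky ay; have := H (-1) y; rewrite normrN1 => /(_ erefl Ky ay).
by rewrite scaleN1r opprB addrA.
Qed.

Lemma mid_double : mid + mid = x + b.
Proof.
by rewrite /mid -scalerDl -rmorphD (_ : 2^-1 + 2^-1 = 1) ?scale1r//; field.
Qed.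

Lemma pairing_b a : pairing a x = 0 -> pairing a b = 0.
Proof. by rewrite /b pairingZr => ->; rewrite mulr0. Qed.

Lemma pairing_mid a : pairing a x = 0 -> pairing a mid = 0.
Proof. by move=> ax; rewrite pairingZr pairingDr ax pairing_b// addr0 mulr0. Qed.

Lemma double_sub_mid c : c + c = x + b + (c - mid) *+ 2.
Proof. by rewrite -mid_double mulr2n; apply/rowP => i; rewrite !mxE; ring. Qed.

Lemma scale2 (u : Cn R n) : (2 : R)%:C *: u = u *+ 2.
Proof. by rewrite (rmorph_nat (real_complex R) 2) scaler_nat. Qed.

(** Reflection in [c] sends [x] to [b + 2 (c - mid)]; it sends [b] to [x + 2 (c - mid)], which
    [Kopp] turns into [b - (2 / r) (c - mid)]. *)
Lemma center_lineality a c : pairing a x = 0 -> section_center a c ->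
  lineality (c - mid).
Proof.
move=> ax ac; split.
  exists 2 => //; have := reflect_section ac Kx ax.
  rewrite double_sub_mid scale2; congr K.
  by apply/rowP => i; rewrite mulr2n !mxE; ring.
exists (2 / r); first by rewrite divr_gt0.
have := Kopp (reflect_section ac Kb (pairing_b ax)).
rewrite double_sub_mid; congr K; apply/rowP => i.
rewrite /b mulr2n !mxE rmorphM (rmorph_nat (real_complex R) 2); ring.
Qed.

(** The point found is the reflection of [b + s u] in [c]. *)
Lemma section_center_far a c : pairing a x = 0 -> section_center a c ->
  forall u, feasible u -> pairing a u = 0 ->
  exists2 s : R, 0 < s & K (x + ((c - mid) *+ 2 - s%:C *: u)).
Proof.
move=> ax ac u [s s0 Ks] au; exists s => //.
have := reflect_section ac Ks.
rewrite pairingDr pairingZr au mulr0 addr0 => /(_ (pairing_b ax)).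
rewrite double_sub_mid; congr K.
by apply/rowP => i; rewrite mulr2n !mxE; ring.
Qed.

(* Otherwise rotating the section of K by a hyperplane through x about its
   centre would push Re <., v> beyond its extrema at x and b. *)
Lemma pairing_vx : pairing (conjv v) x = (rdot x v)%:C.
Proof.
have [a a0 [ax _]] := common_annihilator x x n3.
have [c [ac Hc]] := symK a0.
have Im1 : complex.Im (pairing (conjv v) (x - c)) = 0.
  apply: rotation_max_real => xi xi1.
  have := xmax (Hc xi x xi1 Kx ax).
  have : rdot x v = rdot c v + rdot (x - c) v by rewrite -rdotDl addrC subrK.
  by move=> E; rewrite rdotDl E /rdot pairingZr; lra.
have Im2 : complex.Im (pairing (conjv v) (c - b)) = 0.
  apply: rotation_max_real => xi xi1.
  have := xmin (Hc xi b xi1 Kb (pairing_b ax)).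
  have : rdot b v = rdot c v + rdot (b - c) v by rewrite -rdotDl addrC subrK.
  move=> E; rewrite -rdot_b ler_pM2l// rdotDl E /rdot pairingZr.
  by rewrite -(opprB b c) pairingNr mulrN !ReN; lra.
apply/eqP; rewrite eq_complex /= eqxx /=.
have : complex.Im (pairing (conjv v) (x - b)) = 0.
  by rewrite -(subrKA c) pairingDr ImD Im1 Im2 addr0.
rewrite /b -rmorphN pairingBr pairingZr.
case: (pairing _ x) => [p q] /= h; apply/eqP.
have : (1 + r^-1) * q = 0 by lra.
by move/eqP; rewrite mulf_eq0 gt_eqF ?ltr_pwDl ?ltW ?invr_gt0// => /eqP.
Qed.

(** This value makes [V] vanish at [x], since [<x, v>] is real by [pairing_vx]. As [kappa] is real,
    [rdot w x = kappa * rdot w v] on the kernel of [V]. *)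
Let kappa : R := nsq x / rdot x v.
Let V : Cn R n := conjv x - kappa%:C *: conjv v.

Lemma pairing_Vx : pairing V x = 0.
Proof.
rewrite /V pairingDl pairingNl pairingZl pairing_conjvv pairing_vx -rmorphM.
by rewrite /kappa divfK ?gt_eqF// subrr.
Qed.

(* x + 2(c - mid) and its translates along u stay in the face of K on which
   x is farthest from 0, while V annihilates the directions that would bring
   them closer. *)
Lemma lineality_trivial a c u : pairing a x = 0 -> section_center a c ->
  pairing V (c - mid) = 0 -> lineality u -> pairing a u = 0 -> pairing V u = 0 ->
  c = mid /\ u = 0.
Proof.
move=> ax ac Vc lu au Vu; have le := center_lineality ax ac.
have orth w : pairing V w = 0 -> rdot w v = 0 -> rdot w x = 0.
  rewrite /V pairingDl pairingNl pairingZl => /eqP; rewrite subr_eq0 => /eqP Vw wv.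
  by rewrite /rdot Vw ReZ -/(rdot w v) wv mulr0.
have vanish w : feasible w -> pairing a w = 0 -> pairing V w = 0 -> rdot w v = 0 ->
    exists2 s : R, 0 < s & (c - mid) *+ 2 = s%:C *: w.
  move=> fw aw Vw wv; have [s s0 Ks] := section_center_far ax ac fw aw.
  exists s => //; apply/eqP; rewrite -subr_eq0; apply/eqP.
  set z := _ - _ in Ks *.
  have zv : rdot z v = 0.
    rewrite /z mulr2n rdotDl rdotNl rdotDl rdotZl (lineality_rdot le) wv.
    by rewrite mulr0 !addr0 subrr.
  have zx : rdot z x = 0.
    apply: orth => //; rewrite /z mulr2n pairingBr pairingDr pairingZr Vw Vc.
    by rewrite mulr0 addr0 subrr.
  (* Since [z] is orthogonal to [x], Pythagoras makes [x + z] farther from 0 than [x] unless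
     [z = 0]. *)
  apply: nsq_eq0; have := xfar Ks; rewrite rdotDl zv addr0 => /(_ erefl).
  by rewrite /nsq (rdotDl x z) (rdotDr x z x) (rdotDr x z z) (rdotC x z) zx; lra.
have uv := lineality_rdot lu; have [fu fNu] := lu.
(* [2 (c - mid)] is a positive multiple of both [u] and [- u], so [u = 0]. *)
have [s s0 es] := vanish u fu au Vu uv.
have [|||t t0 et] := vanish (- u) fNu.
- by rewrite pairingNr au oppr0.
- by rewrite pairingNr Vu oppr0.
- by rewrite rdotNl uv oppr0.
have u0 : u = 0.
  have /eqP : (s + t)%:C *: u = 0.
    by rewrite rmorphD scalerDl -es et scalerN addNr.
  rewrite scaler_eq0 => /orP[|/eqP//]; rewrite eq_complex /= eqxx andbT.
  by rewrite gt_eqF// addr_gt0.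
split=> //; apply/eqP; rewrite -subr_eq0; move/eqP: es.
by rewrite u0 scaler0 -scale2 scaler_eq0 eq_complex /= pnatr_eq0.
Qed.

Lemma lineality0 : lineality 0.
Proof. by rewrite /lineality oppr0; split; exact: feasible0. Qed.

Lemma center_mid a c : pairing a x = 0 -> section_center a c ->
  pairing V (c - mid) = 0 -> c = mid.
Proof.
move=> ax ac Vc.
by have [] := lineality_trivial ax ac Vc lineality0 (pairing0r _) (pairing0r _).
Qed.

(** The centre of the section by [ker V] and [mid] both lie in [ker V], so [lineality_trivial]
    applies with [a := V]. *)
Lemma lineality_V u : V != 0 -> lineality u -> pairing V u = 0 -> u = 0.
Proof.
move=> V0 lu Vu; have [c Vc] := symK V0.
have [] // := lineality_trivial pairing_Vx Vc _ lu Vu Vu.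
by rewrite pairingBr Vc.1 pairing_mid ?subrr// pairing_Vx.
Qed.

(** Use the section by [ker V] itself or, if [V = 0], by any hyperplane through 0, [x] and [y];
    either way [V] vanishes at [c - mid]. *)
Lemma rotation_V y (xi : R[i]) : `|xi| = 1 -> K y -> pairing V y = 0 ->
  K (mid + xi *: (y - mid)).
Proof.
move=> xi1 Ky Vy.
have [a a0 [ax ay aV]] : exists2 a, a != 0 & [/\ pairing a x = 0, pairing a y = 0 &
    forall w, pairing a w = 0 -> pairing V w = 0].
  have [V0|V0] := eqVneq V 0; last by exists V => //; rewrite pairing_Vx.
  have [a a0 [ax ay]] := common_annihilator x y n3.
  by exists a => //; split=> // w _; rewrite V0 pairing0l.
have [c ac] := symK a0.
have cm : c = mid.
  by apply: (center_mid ax ac); apply: aV; rewrite pairingBr ac.1 pairing_mid// subrr.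
by rewrite -cm; exact: ac.2.
Qed.

(* In the pencil a + e V all but two real parameters e give sections centred at
   mid: otherwise the real-linear map a o V^-1 on V(lineality space), which has
   real dimension at most 2, would have three distinct real eigenvalues. *)
Lemma pencil_center a (e : 'I_3 -> R) : V != 0 -> pairing a x = 0 ->
  injective e -> (forall i, a + (e i)%:C *: V != 0) ->
  exists i, section_center (a + (e i)%:C *: V) mid.
Proof.
move=> V0 ax einj aeV; apply: contrapT => /forallNP H.
have /choice[c Hc] i := symK (aeV i).
have eVx i : pairing (a + (e i)%:C *: V) x = 0.
  by rewrite pairingDl pairingZl ax pairing_Vx mulr0 addr0.
pose w i := c i - mid; pose z i := pairing V (w i).
have lw i : lineality (w i) := center_lineality (eVx i) (Hc i).
(* A zero [z i] would mean that the centre [c i] is [mid], which [H] excludes. *)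
have z0 i : z i != 0.
  apply/eqP => /(center_mid (eVx i) (Hc i)) cm.
  by apply: (H i); rewrite -cm.
have az i : pairing a (w i) = - (e i)%:C * z i.
  apply/eqP; rewrite mulNr -addr_eq0 -pairingZl -pairingDl /w pairingBr (Hc i).1.
  by rewrite pairing_mid// subrr.
(* By [lineality_V], a real relation among the [z i] lifts to the [w i]; applying [a] then
   multiplies each term by its eigenvalue. *)
have dep (p q s : R) i j k : p%:C * z i + q%:C * z j + s%:C * z k = 0 ->
    p%:C * ((e i)%:C * z i) + q%:C * ((e j)%:C * z j) + s%:C * ((e k)%:C * z k) = 0.
  move=> pz; pose u := p%:C *: w i + q%:C *: w j + s%:C *: w k.
  have u0 : u = 0.
    apply: lineality_V => //; first by do !apply: linealityD; apply: linealityZ.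
    by rewrite /u !pairingDr !pairingZr.
  have := pairing0r a; rewrite -u0 /u !pairingDr !pairingZr !az => /eqP.
  by rewrite -oppr_eq0 => /eqP <-; ring.
pose D i j := complex.Re (z i) * complex.Im (z j) - complex.Im (z i) * complex.Re (z j).
(* If [z i] and [z j] were real multiples of one another, [dep] would force [e i = e j]. *)
have D0 i j : i != j -> D i j != 0.
  move=> ij; apply/eqP => Dij.
  pose N := complex.Re (z j) ^+ 2 + complex.Im (z j) ^+ 2.
  have N0 : N != 0.
    rewrite paddr_eq0 ?sqr_ge0// !sqrf_eq0; apply: contra (z0 j).
    by rewrite eq_complex.
  pose S := complex.Re (z i) * complex.Re (z j) + complex.Im (z i) * complex.Im (z j).
  have Nz : N%:C * z i = S%:C * z j.
    apply: complex_eqP; rewrite !(ReZ, ImZ) /N /S; apply/eqP; rewrite -subr_eq0.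
      by apply/eqP; transitivity (complex.Im (z j) * D i j);
        [rewrite /D; ring|rewrite Dij mulr0].
    by apply/eqP; transitivity (- complex.Re (z j) * D i j);
      [rewrite /D; ring|rewrite Dij mulr0].
  have Nd : (e i - e j)%:C * (N%:C * z i) = 0.
    have := dep N (- S) 0 i j j; rewrite rmorphN rmorph0 mulNr Nz !mul0r subrr addr0.
    move=> /(_ erefl) <-; rewrite rmorphB mulrBl -{1}Nz; ring.
  move/eqP: Nd; rewrite !mulf_eq0 (negbTE (z0 i)) orbF !eq_complex /= eqxx !andbT.
  by rewrite (negbTE N0) orbF subr_eq0 (inj_eq einj) (negbTE ij).
pose i0 : 'I_3 := inord 0; pose i1 : 'I_3 := inord 1; pose i2 : 'I_3 := inord 2.
have n01 : i0 != i1 by rewrite -val_eqE /= !inordK.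
have n02 : i0 != i2 by rewrite -val_eqE /= !inordK.
have n12 : i1 != i2 by rewrite -val_eqE /= !inordK.
(* Cramer's relation between three vectors of the real plane. *)
have cramer : (D i1 i2)%:C * z i0 + (D i2 i0)%:C * z i1 + (D i0 i1)%:C * z i2 = 0.
  by apply: complex_eqP; rewrite !(ReD, ImD, ReZ, ImZ) /= /D; ring.
have E := dep _ _ _ _ _ _ cramer.
have {E}[E1 E2] := (congr1 (@complex.Re R) E, congr1 (@complex.Im R) E).
rewrite !(ReD, ReZ) [RHS]/= in E1; rewrite !(ImD, ImZ) [RHS]/= in E2.
(* Take the determinant of the relation [E] against [z i1]: the middle eigenvalue drops out. *)
have : (e i0 - e i2) * D i1 i2 * D i0 i1 = 0.
  transitivity (complex.Im (z i1) * 0 - complex.Re (z i1) * (0 : R)).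
    by rewrite -{1}E1 -E2 /D; ring.
  by rewrite !mulr0 subrr.
move/eqP; rewrite !mulf_eq0 subr_eq0 (inj_eq einj) (negbTE n02).
by rewrite (negbTE (D0 _ _ n01)) (negbTE (D0 _ _ n12)).
Qed.

(** * Rotating all of [K] about [mid] *)

Lemma nsq_rotate (xi : R[i]) y : `|xi| = 1 -> nsq (xi *: y) = nsq y.
Proof. by move=> xi1; rewrite nsqZ xi1 /= expr1n mul1r. Qed.

(** An interior point can be shifted slightly, within [K], onto hyperplanes of a pencil; one of
    those sections is centred at [mid]. *)
Lemma rotation_interior y (xi : R[i]) (rho : R) : `|xi| = 1 -> 0 < rho ->
  (forall w, nsq w < rho -> K (y + w)) -> K (mid + xi *: (y - mid)).
Proof.
move=> xi1 rho0 Krho.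
have Ky : K y by rewrite -(addr0 y); apply: Krho; rewrite /nsq rdot0l.
have [Vy|Vy] := eqVneq (pairing V y) 0; first exact: rotation_V.
have V0 : V != 0 by apply: contra_neq Vy => ->; rewrite pairing0l.
have [a a0 [ax ay]] := common_annihilator x y n3.
have [z az] := pairing_neq0 a0.
(* [V q = 0] and [a q = - V y], so [y + e q] lies in the kernel of [a + e V] for every [e]. *)
pose q := pairing V z *: y - pairing V y *: z.
have Vq : pairing V q = 0 by rewrite /q pairingBr !pairingZr mulrC subrr.
have aq : pairing a q = - pairing V y.
  by rewrite /q pairingBr !pairingZr ay az mulr0 mulr1 sub0r.
apply: nsq_limit compK _ => delta delta0.
have m0 : 0 < Num.min rho delta by rewrite lt_min rho0.
have [t t0 ts] := small_scale m0 (nsq_ge0 q).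
(* Three distinct small parameters [t], [t / 2], [t / 3], as [pencil_center] requires. *)
pose e (i : 'I_3) : R := t / i.+1%:R.
have e0 i : 0 < e i by rewrite divr_gt0.
have et i : e i <= t by rewrite ler_pdivrMr// ler_peMr ?ler1n// ltW.
have einj : injective e.
  move=> i j /(mulfI (lt0r_neq0 t0))/invr_inj/eqP.
  by rewrite eqr_nat eqSS => /eqP/val_inj.
have aeV i : a + (e i)%:C *: V != 0.
  apply/eqP => /(congr1 (fun w => pairing w y)).
  rewrite pairingDl pairingZl ay add0r pairing0l => /eqP.
  by rewrite mulf_eq0 (negbTE Vy) orbF eq_complex /= gt_eqF.
have [i [_ Hi]] := pencil_center V0 ax einj aeV.
have := ts (e i); rewrite e0 et -rdotZl -rdotZr -/(nsq _) => /(_ erefl).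
rewrite lt_min => /andP[qrho qdelta].
exists (mid + xi *: (y + (e i)%:C *: q - mid)).
  apply: Hi => //; first exact: Krho.
  rewrite pairingDl pairingZl !pairingDr !pairingZr ay aq Vq; ring.
have -> : mid + xi *: (y + (e i)%:C *: q - mid) - (mid + xi *: (y - mid)) =
    xi *: ((e i)%:C *: q).
  by apply/rowP => j; rewrite !mxE; ring.
by rewrite nsq_rotate.
Qed.

Lemma rotation_mid y (xi : R[i]) : `|xi| = 1 -> K y -> K (mid + xi *: (y - mid)).
Proof.
move=> xi1 Ky; apply: nsq_limit compK _ => delta delta0.
have [t t0 ts] := small_scale delta0 (nsq_ge0 y).
pose eta := Num.min t 1.
have eta0 : 0 < eta by rewrite lt_min t0 ltr01.
have eta1 : 0 <= eta <= 1 by rewrite ltW//= ge_min lexx orbT.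
(* Shrinking [y] towards 0 makes it interior: by convexity [K] contains the ball around it scaled by
   [eta]. *)
exists (mid + xi *: ((1 - eta)%:C *: y - mid)).
  apply: (@rotation_interior _ _ (eta ^+ 2 * d)) => //.
    by rewrite mulr_gt0// exprn_gt0.
  move=> w wd; have Kw : K ((eta^-1)%:C *: w).
    apply: ballK; rewrite /nsq rdotZl rdotZr -/(nsq w) mulrA -expr2 exprVn.
    by rewrite ltr_pdivrMl// exprn_gt0.
  have := convK Kw Ky eta1.
  by rewrite scalerA -rmorphM divff ?gt_eqF// rmorph1 scale1r addrC.
have -> : mid + xi *: ((1 - eta)%:C *: y - mid) - (mid + xi *: (y - mid)) =
    xi *: (- (eta%:C *: y)).
  by apply/rowP => j; rewrite !mxE rmorphB rmorph1; ring.
rewrite nsq_rotate// nsqN /nsq rdotZl rdotZr; apply: ts.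
by rewrite eta0 ge_min lexx.
Qed.
End Core.

(** * Assembly and translation to an arbitrary [x0] *)

Lemma symmetric_of_central_sections (R : realType) (n : nat) (K : set (Cn R n))
    (d : R) : (3 <= n)%N -> convex_in K -> compact K ->
  0 < d -> (forall y, nsq y < d -> K y) ->
  (forall a, a != 0 -> exists c, section_center K a c) ->
  exists c : Cn R n, forall (xi : R[i]) y, `|xi| = 1 -> K y -> K (c + xi *: (y - c)).
Proof.
move=> n3 cvK cK d0 dK symK.
have [v [r [x1 [[r0 Kx1 x1v] vmax vmin Kopp]]]] :=
  extremal_chord cvK cK d0 dK (leq_trans (isT : 1 <= 3)%N n3).
(* The endpoint [x1] is replaced by a farthest point [x] of the face of [K] where [rdot _ v] is
   maximal. *)
have cF := compact_level (c := rdot x1 v) cK (@rdot_continuous R n v).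
have [//||x] := @compact_EVT_max _ R (@nsq R n) _ _ cF.
- by exists x1.
- exact/continuous_subspaceT/nsq_continuous.
rewrite inE => -[Kx /= xv] xfar; rewrite -xv in x1v vmax vmin.
have {}xfar y : K y -> rdot y v = rdot x v -> nsq y <= nsq x.
  by move=> Ky yv; apply: xfar; rewrite inE; split=> //=; rewrite yv.
exists ((2^-1)%:C *: (x + (- (r^-1)%:C *: x))) => xi y xi1 Ky.
exact: (rotation_mid n3 cvK cK d0 dK symK r0 Kx x1v vmax vmin Kopp xfar xi1 Ky).
Qed.

Lemma cplx_symmetric_rotation (R : realType) (n : nat) (A : set (Cn R n)) c
    (xi : R[i]) y : `|xi| = 1 ->
  (fun y => xi *: y) @` ((fun y => y - c) @` A) = (fun y => y - c) @` A ->
  A y -> A (c + xi *: (y - c)).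
Proof.
move=> xi1 E Ay; have : ((fun y => y - c) @` A) (xi *: (y - c)).
  by rewrite -E; exists (y - c) => //; exists y.
by move=> [z Az /= <-]; rewrite addrC subrK.
Qed.

Unset Implicit Arguments.
Set Strict Implicit.

Theorem theorem2p4 (R : realType) (n : nat) (K : set (Cn R n)) (x0 : Cn R n) :
  (3 <= n)%N ->
  convex_body K ->
  (interior K) x0 ->
  (forall H : set (Cn R n), cplx_hyperplane_through x0 H ->
     cplx_symmetric (H `&` K)) ->
  cplx_symmetric K.
Proof.
move=> n3 [cvK cK _] Kx0 symH.
have [d d0 dK] := nbhs_nsq Kx0.
pose B : set (Cn R n) := [set y | K (y + x0)].
have cvB : convex_in B.
  move=> y z Ky Kz t t01; have := cvK _ _ Ky Kz t t01.
  rewrite /B /=; congr K; apply/rowP => i; rewrite !mxE rmorphB rmorph1; ring.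
have cB : compact B.
  have -> : B = (fun y : Cn R n => y - x0) @` K.
    apply/seteqP; split=> [y Ky|_ [y Ky <-]]; last by rewrite /B /= subrK.
    by exists (y + x0) => //; rewrite addrK.
  apply: continuous_compact cK; apply: continuous_subspaceT => y.
  exact: (cvgB cvg_id (cvg_cst _)).
have [|c Hc] := symmetric_of_central_sections n3 cvB cB d0 dK.
  move=> a a0.
  pose H : set (Cn R n) := [set y | \sum_(i < n) a 0 i * (y 0 i - x0 0 i) = 0].
  have HE y : H y <-> pairing a (y - x0) = 0.
    rewrite /H /= /pairing; under [in X in _ <-> X]eq_bigr do rewrite !mxE.
    by [].
  have [c Hc] := symH H (ex_intro _ a (conj a0 erefl)).
  have rot (xi : R[i]) y : `|xi| = 1 -> (H `&` K) y -> (H `&` K) (c + xi *: (y - c)).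
    by move=> xi1; apply: cplx_symmetric_rotation => //; exact: Hc.
  have Hx0 : (H `&` K) x0.
    by split; [apply/HE; rewrite subrr pairing0r|exact: interior_subset].
  exists (c - x0); split.
    (* Symmetry alone does not place [c] in [H]; the reflection of [x0] in [c] lies in [H], which
       forces it. *)
    have [] := rot (-1) x0 _ Hx0; first by rewrite normrN1.
    have -> : c + -1 *: (x0 - c) = (c - x0) + (c - x0) + x0.
      by apply/rowP => i; rewrite !mxE; ring.
    move=> /HE; rewrite addrK pairingDr -mulr2n => /eqP.
    by rewrite mulrn_eq0 /= => /eqP.
  move=> xi y xi1 Ky ay; have [] := rot xi (y + x0) xi1.
    by split=> //; apply/HE; rewrite addrK.
  by move=> _; rewrite /B /=; congr K; apply/rowP => i; rewrite !mxE; ring.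
pose c0 : Cn R n := c + x0.
have rot (xi : R[i]) y : `|xi| = 1 -> K y -> K (c0 + xi *: (y - c0)).
  move=> xi1 Ky; have := Hc xi (y - x0) xi1; rewrite /B /= subrK => /(_ Ky).
  by congr K; apply/rowP => i; rewrite /c0 !mxE; ring.
exists c0 => xi xi1; have xi0 : xi != 0 by rewrite -normr_eq0 xi1 oner_eq0.
apply/seteqP; split=> [_ [_ [y Ky <-] <-]|_ [y Ky <-]].
  by exists (c0 + xi *: (y - c0)); [exact: rot|rewrite addrC addKr].
(* The reverse inclusion rotates by [xi^-1], again unimodular. *)
exists (xi^-1 *: (y - c0)); last by rewrite scalerA divff// scale1r.
exists (c0 + xi^-1 *: (y - c0)); last by rewrite addrC addKr.
by apply: rot => //; rewrite normfV xi1 invr1.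
Qed.
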